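(* Let $G = P_{n_1}\square P_{n_2}\square\cdots\square P_{n_k}$ be a Cartesian product of $k$ paths, where $n_i \neq n_j$ for $i\neq j$ and $n_i\geq 3$ for all $i\in\{1,\dots,k\}$. Then $\rho'(G)=\rho(G)=1$.
   Context: $P_n$ is the path on $n$ vertices and $\square$ is the Cartesian product of graphs. A vertex (or edge) coloring of a graph is distinguishing if no automorphism other than the identity preserves it. $D(G)$ (resp. $D'(G)$) is the least number of colors in a distinguishing vertex (resp. edge) coloring of $G$. When $D(G)=2$, the cost of distinguishing $\rho(G)$ is the minimum number of vertices in the smaller color class over all distinguishing vertex colorings of $G$ with two colors. When $D'(G)=2$, the cost of edge-distinguishing $\rho'(G)$ is the minimum number of edges in the smaller color class over all distinguishing edge colorings of $G$ with two colors. *)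

(* Defs.v *)
From HB Require Import structures.
From mathcomp Require Import all_boot all_fingroup.

Set Implicit Arguments.
Unset Strict Implicit.
Unset Printing Implicit Defensive.

Record sgraph := SGraph {
  vertex :> finType;
  adj : rel vertex;
  adj_sym : symmetric adj;
  adj_irrefl : irreflexive adj
}.

Definition edges (G : sgraph) : {set {set G}} :=
  [set e | [exists x, exists y, adj x y && (e == [set x; y])]].

Definition edge (G : sgraph) : finType := {e : {set G} | e \in edges G}.

Definition autg (G : sgraph) : {set {perm G}} :=
  [set s : {perm G} | [forall x, forall y, adj (s x) (s y) == adj x y]].

Lemma autg_edge (G : sgraph) (s : {perm G}) (e : {set G}) :
  s \in autg G -> e \in edges G -> s @: e \in edges G.
Proof.
rewrite !inE => /forallP sP /existsP[x /existsP[y /andP[xy /eqP->]]].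
rewrite imsetU !imset_set1; apply/existsP; exists (s x); apply/existsP.
by exists (s y); move/forallP: (sP x) => /(_ y)/eqP->; rewrite xy eqxx.
Qed.

Section PathGraph.
Variable n : nat.

Definition path_adj : rel 'I_n := fun i j => (i.+1 == j) || (j.+1 == i).

Lemma path_adj_sym : symmetric path_adj.
Proof. by move=> i j; rewrite /path_adj orbC. Qed.

Lemma path_adj_irrefl : irreflexive path_adj.
Proof. by move=> i; rewrite /path_adj orbb gtn_eqF. Qed.

Definition path_graph : sgraph := SGraph path_adj_sym path_adj_irrefl.
End PathGraph.

Section CartesianProduct.
Variables (I : finType) (G : I -> sgraph).

Definition cart_vertex : finType := {dffun forall i : I, G i}.

Definition cart_adj : rel cart_vertex := fun u v =>
  [exists i, adj (u i) (v i) && [forall j, (j != i) ==> (u j == v j)]].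

Lemma cart_adj_sym : symmetric cart_adj.
Proof.
move=> u v; apply: eq_existsb => i; rewrite adj_sym.
by under eq_forallb do rewrite [u _ == _]eq_sym.
Qed.

Lemma cart_adj_irrefl : irreflexive cart_adj.
Proof. by move=> u; apply/negbTE/existsP; case=> i; rewrite adj_irrefl. Qed.

Definition cart_prod : sgraph := SGraph cart_adj_sym cart_adj_irrefl.
End CartesianProduct.

Section Distinguishing.
Variable G : sgraph.

Definition distinguishing d (c : {ffun G -> 'I_d}) : Prop :=
  forall s : {perm G}, s \in autg G -> (forall x, c (s x) = c x) -> s = 1%g.

(* By [autg_edge], every edge [e] has exactly one edge [f] as its image
   under an automorphism [s]. *)
Definition edge_distinguishing d (c : {ffun edge G -> 'I_d}) : Prop :=
  forall s : {perm G}, s \in autg G ->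
    (forall e f : edge G, val f = s @: val e -> c f = c e) -> s = 1%g.
End Distinguishing.

Definition is_least (P : nat -> Prop) (m : nat) : Prop :=
  P m /\ forall n, P n -> m <= n.

Definition smaller_class (T : finType) (c : {ffun T -> 'I_2}) : nat :=
  minn #|[set x | c x == ord0]| #|[set x | c x == ord_max]|.

(* The parameters below are relations, e.g. [is_D' G d] means D'(G) = d:
   D'(G) does not exist for some graphs (such as K_2), and the costs rho and
   rho' are defined only when D(G) = 2, respectively D'(G) = 2. *)

Definition is_D (G : sgraph) : nat -> Prop :=
  is_least (fun d => exists c : {ffun G -> 'I_d}, distinguishing c).

Definition is_D' (G : sgraph) : nat -> Prop :=
  is_least (fun d => exists c : {ffun edge G -> 'I_d}, edge_distinguishing c).

Definition is_rho (G : sgraph) (r : nat) : Prop :=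
  is_D G 2 /\
  is_least (fun m => exists2 c : {ffun G -> 'I_2},
    distinguishing c & smaller_class c = m) r.

Definition is_rho' (G : sgraph) (r : nat) : Prop :=
  is_D' G 2 /\
  is_least (fun m => exists2 c : {ffun edge G -> 'I_2},
    edge_distinguishing c & smaller_class c = m) r.

(* Main.v *)
Require Import Defs.
From HB Require Import structures.
From mathcomp Require Import all_boot all_fingroup.
From mathcomp Require Import zify.

Set Implicit Arguments.
Unset Strict Implicit.
Unset Printing Implicit Defensive.

(** Rank the vertices of the box [G] by the sum of their coordinates.  An
    automorphism [s] fixing the corner [0] preserves the rank, hence also the
    componentwise order, so it permutes the atoms [e_i] and sends the multiples
    [a e_i] to multiples of one atom [e_j].  Comparing the lengths of these
    axes, for [s] and for its inverse, gives [n_i = n_j], so [i = j]; then [s]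
    fixes every [a e_i], and a vertex is the join of the [a e_i] below it.
    Coloring the corner differently from the rest is thus distinguishing.  So
    is coloring the edge [{0, e_i}] differently, as [0] has degree [k] and
    [e_i] has degree [k + 1].  One color never suffices, because of the central
    symmetry of the box. *)

(** * Automorphisms of a graph: inverses and degrees *)

Lemma autgP (G : sgraph) (s : {perm G}) :
  reflect (forall x y, adj (s x) (s y) = adj x y) (s \in autg G).
Proof.
rewrite inE; apply: (iffP forallP) => [h x y|h x].
  by move/forallP: (h x) => /(_ y)/eqP.
by apply/forallP => y; rewrite h.
Qed.

Lemma autgV (G : sgraph) (s : {perm G}) : s \in autg G -> s^-1%g \in autg G.
Proof. by move/autgP=> sP; apply/autgP => x y; rewrite -sP !permKV. Qed.

Lemma autg_degree (G : sgraph) (s : {perm G}) (x : G) :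
  s \in autg G -> #|[set y | adj (s x) y]| = #|[set y | adj x y]|.
Proof.
move/autgP=> sP; rewrite -(card_imset [set y | adj x y] (@perm_inj _ s)).
apply: eq_card => y; rewrite inE; apply/idP/imsetP => [h|[z + ->]].
  by exists ((s^-1)%g y); rewrite ?permKV // inE -sP permKV.
by rewrite inE sP.
Qed.

(** * Two-colorings with an empty or a singleton class *)

Section SmallerClass.
Variable T : finType.

Lemma smaller_class0 (c : {ffun T -> 'I_2}) :
  smaller_class c = 0 -> forall x y, c x = c y.
Proof.
have c01 z : c z = ord0 \/ c z = ord_max.
  by case: (c z) => -[|[]] // h; [left|right]; apply: val_inj.
move=> h x y; apply: val_inj => /=.
have: (#|[set z | c z == ord0]| == 0) || (#|[set z | c z == ord_max]| == 0).
  by move: h; rewrite /smaller_class; lia.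
case/orP; rewrite cards_eq0 => /eqP/setP e; have := (e x, e y);
  rewrite !inE => -[]; case: (c01 x) => ->; case: (c01 y) => -> //.
Qed.

Definition single_coloring (a : T) : {ffun T -> 'I_2} :=
  [ffun x => if x == a then ord_max else ord0].

Lemma single_coloring_eq (a x : T) :
  single_coloring a x = single_coloring a a -> x = a.
Proof. by rewrite !ffunE eqxx; case: eqP. Qed.

(** Only an upper bound: if [a] is the sole element of [T], the other class is empty and the minimum
    is 0. *)
Lemma smaller_class_single (a : T) : smaller_class (single_coloring a) <= 1.
Proof.
rewrite geq_min; apply/orP; right.
rewrite (_ : [set x | _] = [set a]) ?cards1 //.
by apply/setP => x; rewrite !inE ffunE; case: (x == a).
Qed.

End SmallerClass.

(** * Coordinates and adjacency in the box *)

Section Box.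
Variables (I : finType) (n : I -> nat).
Hypothesis n_gt1 : forall i, 1 < n i.

Let G := cart_prod (fun i => path_graph (n i)).

Definition coord (x : G) (i : I) : nat := val (x i : 'I_(n i)).

(** Coordinates are given as plain numbers, without bound proofs; a value that is out of range is
    replaced by 0. *)
Definition box_of (f : I -> nat) : G :=
  [ffun i => insubd (Ordinal (ltnW (n_gt1 i))) (f i) : path_graph (n i)].

Lemma ltn_coord x i : coord x i < n i.
Proof. exact: ltn_ord. Qed.

Lemma coord_box_of f i : f i < n i -> coord (box_of f) i = f i.
Proof. by move=> h; rewrite /coord ffunE val_insubd h. Qed.

Lemma coord_inj x y : coord x =1 coord y -> x = y.
Proof. by move=> h; apply/ffunP => i; apply: val_inj; apply: h. Qed.

Definition origin : G := box_of (fun=> 0).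

(** The multiple [a] e_i, provided [a < n i]; the Boolean [j == i] is read as 0 or 1. *)
Definition axis (i : I) (a : nat) : G := box_of (fun j => (j == i) * a).

Lemma coord_origin i : coord origin i = 0.
Proof. by rewrite coord_box_of // ltnW. Qed.

Lemma coord_axis i a j : a < n i -> coord (axis i a) j = (j == i) * a.
Proof.
move=> h; rewrite coord_box_of //; case: eqP => [->|_]; rewrite ?mul1n //.
exact: ltnW.
Qed.

Lemma axis1_inj : injective (axis^~ 1).
Proof.
move=> i j /(congr1 (coord^~ i)); rewrite !coord_axis // eqxx.
by case: eqP.
Qed.

(** An edge in direction [i], oriented away from the corner. *)
Definition step (i : I) (x y : G) := forall j, coord y j = coord x j + (j == i).

Lemma adjP x y : adj x y <-> exists i, step i x y \/ step i y x.
Proof.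
split=> [/existsP[i /andP[/orP h /forallP eqj]]|[i h]].
  have e j : j != i -> coord x j = coord y j.
    by move=> ji; move: (eqj j); rewrite ji => /eqP; rewrite /coord => ->.
  exists i; case: h => /eqP h; [left|right] => j.
    by have [->|/e->] := eqVneq j i; rewrite ?addn0 // addn1; apply: esym h.
  by have [->|/e->] := eqVneq j i; rewrite ?addn0 // addn1; apply: esym h.
apply/existsP; exists i; apply/andP; split.
  by rewrite /= /path_adj; case: h => /(_ i); rewrite /coord eqxx /= => ->;
    rewrite addn1 eqxx ?orbT.
apply/forallP => j; apply/implyP => /negbTE ji; apply/eqP; apply: val_inj.
by case: h => /(_ j); rewrite /coord ji addn0.
Qed.

Lemma step_adj i x y : step i x y -> adj x y.
Proof. by move=> h; apply/adjP; exists i; left. Qed.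

Lemma step_origin_axis i : step i origin (axis i 1).
Proof. by move=> j; rewrite coord_origin coord_axis // muln1. Qed.

Lemma step_inj i x y y' : step i x y -> step i x y' -> y = y'.
Proof. by move=> h h'; apply: coord_inj => j; rewrite h h'. Qed.

Lemma step_pred i x : 0 < coord x i -> exists y, step i y x.
Proof.
move=> h; exists (box_of (fun j => coord x j - (j == i))) => j.
rewrite coord_box_of; last by apply: leq_ltn_trans (ltn_coord x j); lia.
by case: eqP => [->|]; lia.
Qed.

(** * The rank function and the componentwise order *)

Definition level (x : G) := \sum_i coord x i.

Lemma level_origin : level origin = 0.
Proof. by rewrite /level big1 // => i _; rewrite coord_origin. Qed.

Lemma level_step i x y : step i x y -> level y = (level x).+1.
Proof.
move=> h; rewrite /level (eq_bigr _ (fun j _ => h j)) big_split /= -addn1.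
by congr (_ + _); rewrite -big_mkcond big_pred1_eq.
Qed.

Lemma level_axis i a : a < n i -> level (axis i a) = a.
Proof.
move=> h; rewrite /level (bigD1 i) //= coord_axis // eqxx mul1n big1 ?addn0 //.
by move=> j /negbTE ji; rewrite coord_axis // ji.
Qed.

Lemma level_pred x : x <> origin -> exists i y, step i y x.
Proof.
move=> x0; have [/existsP[i /step_pred[y]]|/existsPn h] :=
  boolP [exists i, 0 < coord x i]; first by exists i, y.
case: x0; apply: coord_inj => i; move: (h i); rewrite coord_origin; lia.
Qed.

Lemma level1 x : level x = 1 -> exists i, x = axis i 1.
Proof.
move=> x1; have [|i [y yx]] := @level_pred x.
  by move=> e; rewrite e level_origin in x1.
exists i; suff y0: y = origin.
  by apply: step_inj (step_origin_axis i); rewrite -y0.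
(* Otherwise [y] has a predecessor too, and [x] has level at least 2. *)
have [//|yn] := eqVneq y origin; case: (level_pred (elimN eqP yn)) => j [z zy].
by move: x1; rewrite (level_step yx) (level_step zy).
Qed.

Definition box_le (x y : G) := forall i, coord x i <= coord y i.

Lemma axis_le i a x : a <= coord x i -> box_le (axis i a) x.
Proof.
move=> h j; rewrite coord_axis; last exact: leq_ltn_trans (ltn_coord x i).
by case: eqP => [->|]; lia.
Qed.

(** * Automorphisms fixing the corner *)

Section FixOrigin.
Variable s : {perm G}.
Hypotheses (s_aut : s \in autg G) (s_origin : s origin = origin).

Lemma fix_originV : (s^-1)%g origin = origin.
Proof. by rewrite -{1}s_origin permK. Qed.

(** Induction on the level: a predecessor [y] of [x] does not rise, and [s x], being adjacent to
    [s y], lies at most one level above it. *)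
Lemma leq_level_fix x : level (s x) <= level x.
Proof.
have [m] := ubnP (level x); elim: m x => // m IHm x xm.
have [->|/eqP/level_pred[i [y yx]]] := eqVneq x origin; first by rewrite s_origin.
have ex := level_step yx.
have /IHm: level y < m by lia.
have: adj (s y) (s x) by rewrite (elimT (autgP _) s_aut) (step_adj yx).
case/adjP => j [] /level_step; lia.
Qed.

End FixOrigin.

Lemma level_fix s x : s \in autg G -> s origin = origin -> level (s x) = level x.
Proof.
move=> sA s0; apply/eqP; rewrite eqn_leq leq_level_fix //=.
by rewrite -{1}(permK s x) leq_level_fix ?autgV ?fix_originV.
Qed.

(** Induction along a descending chain from [y] to [x]: if [z] is a predecessor of [y] still above
    [x], then [s z] and [s y] are adjacent, and preservation of levels forces this edge to go up. *)
Lemma le_fix s x y : s \in autg G -> s origin = origin ->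
  box_le x y -> box_le (s x) (s y).
Proof.
move=> sA s0; have [m] := ubnP (level y); elim: m y => // m IHm y ym xy.
have [/existsP[i xyi]|/existsPn h] := boolP [exists i, coord x i < coord y i];
  last first.
  suff ->: x = y by [].
  by apply: coord_inj => i; move: (h i) (xy i); lia.
have [|z zy] := @step_pred i y; first by lia.
have ez := level_step zy.
have /IHm: level z < m by lia.
have xz: box_le x z.
  by move=> j; move: (zy j) (xy j); case: eqP => [->|_]; lia.
move=> /(_ xz) sxz j; apply: leq_trans (sxz j) _.
have: adj (s z) (s y) by rewrite (elimT (autgP _) sA) (step_adj zy).
case/adjP => l [szy|/level_step]; first by rewrite szy leq_addr.
by rewrite !level_fix // ez; lia.
Qed.

(** If coordinate [q] of the image is positive, e_q lies below it; pulled back by the inverse of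
    [s], e_q becomes an atom below [a] e_i, which must be e_i, so [q = j]. The level then determines
    the remaining coordinate. *)
Lemma coord_fix_axis s i j a p : s \in autg G -> s origin = origin ->
  s (axis i 1) = axis j 1 -> a < n i -> coord (s (axis i a)) p = (p == j) * a.
Proof.
move=> sA s0 sij ai; set z := s _.
have supp q : q != j -> coord z q = 0.
  apply: contra_neq_eq; rewrite -lt0n => /axis_le qz.
  have := le_fix (autgV sA) (fix_originV s0) qz; rewrite permK => le_qi.
  have: level ((s^-1)%g (axis q 1)) = 1.
    by rewrite level_fix ?autgV ?fix_originV // level_axis.
  case/level1 => l el; suff li: l = i.
    by apply: axis1_inj; rewrite -sij -li -el permKV.
  by move: (le_qi l); rewrite el !coord_axis // eqxx; case: eqP.
have [->|/supp->//] := eqVneq p j; rewrite mul1n -(level_axis ai) -(level_fix _ sA s0).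
by rewrite /level (bigD1 j) //= big1 ?addn0.
Qed.

(** The far end of axis [i] is sent to a vertex whose coordinate [j] is [(n i).-1], which must be
    less than [n j]. *)
Lemma leq_fix_axis s i j : s \in autg G -> s origin = origin ->
  s (axis i 1) = axis j 1 -> n i <= n j.
Proof.
move=> sA s0 sij; have ni: (n i).-1 < n i by move: (n_gt1 i); lia.
have := coord_fix_axis j sA s0 sij ni; have := ltn_coord (s (axis i (n i).-1)) j.
by rewrite eqxx; lia.
Qed.

(** * The central symmetry, which excludes constant colorings *)

Definition box_rev (x : G) : G :=
  [ffun i => rev_ord (x i : 'I_(n i)) : path_graph (n i)].

Lemma coord_rev x i : coord (box_rev x) i = n i - (coord x i).+1.
Proof. by rewrite /coord ffunE. Qed.

Lemma box_revK : involutive box_rev.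
Proof.
by move=> x; apply: coord_inj => i; rewrite !coord_rev; move: (ltn_coord x i); lia.
Qed.

Lemma step_rev i x y : step i x y -> step i (box_rev y) (box_rev x).
Proof.
move=> h j; rewrite !coord_rev; move: (h j) (ltn_coord y j) (ltn_coord x j).
by case: eqP => _; lia.
Qed.

Definition rev_perm : {perm G} := perm (can_inj box_revK).

Lemma rev_perm_autg : rev_perm \in autg G.
Proof.
have revP x y : adj x y -> adj (box_rev x) (box_rev y).
  by case/adjP => i h; apply/adjP; exists i; case: h => /step_rev; [right|left].
apply/autgP => x y; rewrite !permE; apply/idP/idP => [/revP|]; last exact: revP.
by rewrite !box_revK.
Qed.

Lemma rev_perm_neq1 (i : I) : rev_perm <> 1%g.
Proof.
move/permP/(_ origin); rewrite perm1 permE => /(congr1 (coord^~ i)).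
by rewrite coord_rev coord_origin; move: (n_gt1 i); lia.
Qed.

Lemma distinguishing_nonconst (i : I) d (c : {ffun G -> 'I_d}) :
  distinguishing c -> ~ (forall x y, c x = c y).
Proof. by move=> cD cc; case: (rev_perm_neq1 i); apply: cD rev_perm_autg _. Qed.

Lemma edge_distinguishing_nonconst (i : I) d (c : {ffun edge G -> 'I_d}) :
  edge_distinguishing c -> ~ (forall x y, c x = c y).
Proof. by move=> cD cc; case: (rev_perm_neq1 i); apply: cD rev_perm_autg _. Qed.

(** * Degrees at the corner and at an atom *)

Lemma degree_origin : #|[set y | adj origin y]| <= #|I|.
Proof.
rewrite -cardsT; apply: leq_trans (leq_imset_card (axis^~ 1) [set: I]).
apply: subset_leq_card; apply/subsetP => y; rewrite inE => /adjP[i [h|/level_step]].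
  by apply/imsetP; exists i; rewrite ?(step_inj h (step_origin_axis i)).
(* No edge goes down from the corner, whose level is 0. *)
by rewrite level_origin.
Qed.

(** The neighbors counted are the corner and the vertices e_i + e_j; for [j = i] the latter is 2
    e_i, which exists because [n i] exceeds 2. *)
Lemma degree_axis i : (forall j, 2 < n j) -> #|I| < #|[set y | adj (axis i 1) y]|.
Proof.
move=> n_gt2; pose f j := box_of (fun l => (l == i) + (l == j)).
have coord_f j l : coord (f j) l = (l == i) + (l == j).
  by rewrite coord_box_of //; move: (n_gt2 l); case: eqP; case: eqP; lia.
have step_f j : step j (axis i 1) (f j).
  by move=> l; rewrite coord_f coord_axis // muln1.
have f_inj : injective f.
  move=> j j' /(congr1 (coord^~ j)); rewrite !coord_f eqxx.
  by case: (j =P j') => // _; lia.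
have f_neq0 : origin \notin f @: [set: I].
  apply/imsetP => -[j _ /(congr1 level)].
  by rewrite level_origin (level_step (step_f j)).
have := cardsU1 origin (f @: [set: I]).
rewrite f_neq0 (card_imset _ f_inj) cardsT add1n => <-.
apply: subset_leq_card; apply/subsetP => y; rewrite !inE.
case/orP => [/eqP->|/imsetP[j _ ->]]; last exact: step_adj (step_f j).
by rewrite adj_sym (step_adj (step_origin_axis i)).
Qed.

(** Otherwise [s] would send the corner to e_i, against the degrees. *)
Lemma fix_edge_origin s i : (forall j, 2 < n j) -> s \in autg G ->
  s @: [set origin; axis i 1] = [set origin; axis i 1] -> s origin = origin.
Proof.
move=> n_gt2 sA /setP/(_ (s origin)).
rewrite imsetU !imset_set1 !inE eqxx /= => /esym/orP[/eqP//|/eqP s0].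
have := autg_degree origin sA; rewrite s0.
by have := degree_axis i n_gt2; have := degree_origin; lia.
Qed.

(** * Rigidity when the side lengths are distinct *)

Section Distinct.
Hypothesis n_inj : injective n.

Lemma fix_axis1 s i : s \in autg G -> s origin = origin ->
  s (axis i 1) = axis i 1.
Proof.
move=> sA s0; have [|j sij] := @level1 (s (axis i 1)).
  by rewrite level_fix // level_axis.
rewrite sij; congr (axis _ 1); apply/esym/n_inj/eqP.
rewrite eqn_leq (leq_fix_axis sA s0 sij) (leq_fix_axis (autgV sA)) //.
  exact: fix_originV.
by rewrite -sij permK.
Qed.

(** Each axis point below [x] is fixed by [s], hence also lies below [s x]. Applied to the inverse
    as well, this yields equality. *)
Lemma fix_origin_le s x : s \in autg G -> s origin = origin -> box_le x (s x).
Proof.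
move=> sA s0 i; have /(_ i) := le_fix sA s0 (axis_le (leqnn (coord x i))).
rewrite (coord_fix_axis _ sA s0 (fix_axis1 i sA s0)) ?ltn_coord //.
by rewrite eqxx mul1n.
Qed.

Lemma fix_origin1 s : s \in autg G -> s origin = origin -> s = 1%g.
Proof.
move=> sA s0; apply/permP => x; rewrite perm1; apply: coord_inj => i.
apply/eqP; rewrite eqn_leq fix_origin_le // andbT.
have := fix_origin_le (s x) (autgV sA) (fix_originV s0) i.
by rewrite permK.
Qed.

Lemma distinguishing_origin : distinguishing (single_coloring origin).
Proof.
move=> s sA sc; apply: fix_origin1 => //.
exact: single_coloring_eq (sc origin).
Qed.

Lemma edge_distinguishing_axis (i : I) (e : edge G) : (forall j, 2 < n j) ->
  val e = [set origin; axis i 1] -> edge_distinguishing (single_coloring e).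
Proof.
move=> n_gt2 ve s sA sc; apply: fix_origin1 => //.
apply: (fix_edge_origin n_gt2 sA (i := i)); rewrite -ve.
(* The image of [e], packaged as an edge so that it has a color; only [e] itself has the color of
   [e]. *)
pose f : edge G := Sub (s @: val e) (autg_edge sA (valP e)).
have fs : val f = s @: val e by rewrite SubK.
by rewrite -fs (single_coloring_eq (sc e f fs)).
Qed.

End Distinct.

Lemma edge_axis (i : I) : [set origin; axis i 1] \in edges G.
Proof.
rewrite inE; apply/existsP; exists origin; apply/existsP; exists (axis i 1).
by rewrite (step_adj (step_origin_axis i)) eqxx.
Qed.

End Box.

(** * Least number of colors and cost, for vertices and edges alike *)

Lemma is_least_cost (T : finType) (P : forall d, {ffun T -> 'I_d} -> Prop) (a : T) :
  (forall d (c : {ffun T -> 'I_d}), P d c -> ~ forall x y, c x = c y) ->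
  P 2 (single_coloring a) ->
  is_least (fun d => exists c : {ffun T -> 'I_d}, P d c) 2 /\
  is_least (fun m => exists2 c : {ffun T -> 'I_2}, P 2 c & smaller_class c = m) 1.
Proof.
move=> Pn Pa.
have class_gt0 (c : {ffun T -> 'I_2}) : P 2 c -> 0 < smaller_class c.
  by move=> /Pn Pc; rewrite lt0n; apply/eqP => /smaller_class0.
split; split.
- by exists (single_coloring a).
(* With at most one color available, [c] would be constant. *)
- move=> d [c /Pn Pc]; rewrite ltnNge; apply/negP => d1; apply: Pc => x y.
  by apply: ord_inj; move: (ltn_ord (c x)) (ltn_ord (c y)); lia.
- exists (single_coloring a) => //; apply/eqP.
  by rewrite eqn_leq smaller_class_single class_gt0.
- by move=> m [c Pc <-]; apply: class_gt0.
Qed.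

Theorem theorem5p2 (k : nat) (n : 'I_k -> nat)
  (k_gt0 : 0 < k)
  (n_distinct : forall i j : 'I_k, i <> j -> n i <> n j)
  (n_ge3 : forall i : 'I_k, 3 <= n i) :
  is_rho' (cart_prod (fun i : 'I_k => path_graph (n i))) 1 /\
  is_rho (cart_prod (fun i : 'I_k => path_graph (n i))) 1.
Proof.
have n_gt1 i : 1 < n i by exact: ltnW.
have n_inj : injective n.
  by move=> i j eij; case: (i =P j) => // /n_distinct.
(* Any direction would serve for the distinguished edge at the corner. *)
pose i0 := Ordinal k_gt0; split.
  pose e : edge (cart_prod (fun i => path_graph (n i))) :=
    Sub [set origin n_gt1; axis n_gt1 i0 1] (edge_axis n_gt1 i0).
  apply: (is_least_cost (P := fun d c => edge_distinguishing c) (a := e)).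
    exact: (edge_distinguishing_nonconst n_gt1 i0).
  by apply: edge_distinguishing_axis; rewrite ?SubK.
apply: (is_least_cost (P := fun d c => distinguishing c) (a := origin n_gt1)).
  exact: (distinguishing_nonconst n_gt1 i0).
exact: distinguishing_origin.
Qed.
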